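(* There exists $\varepsilon_0>0$ such that for every real $\varepsilon$ with $0<\varepsilon\le\varepsilon_0$ and every real $p$ with $0<p<1$ there is $n_0=n_0(\varepsilon,p)$ such that for every $n\ge n_0$, every graph $G=(V,E)$ on $n$ vertices with density at least $p$ contains an induced $(1+\varepsilon)$-nearly regular subgraph on at least $$0.5\left(\frac{\varepsilon}{6}\right)^{\frac{144}{\varepsilon^2}\ln(1/p)}\cdot n$$ vertices.
   Context: All graphs are finite and simple. The density of a graph $G=(V,E)$ is $|E|/\binom{|V|}{2}$. $\Delta(G)$ and $\delta(G)$ denote the maximum and minimum degree of $G$. For a real $c\ge 1$, a graph $G$ is $c$-nearly regular if $\Delta(G)\le c\cdot\delta(G)$. *)

(* Defs.v *)
From mathcomp Require Import all_boot all_order all_algebra.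
From mathcomp Require Import reals.

Set Implicit Arguments.
Unset Strict Implicit.
Unset Printing Implicit Defensive.

Import Order.TTheory GRing.Theory Num.Theory.

Record sgraph := SGraph {
  vertex :> finType;
  adj : rel vertex;
  adj_sym : symmetric adj;
  adj_irr : irreflexive adj
}.

Definition edges (G : sgraph) : {set {set G}} :=
  [set [set z.1; z.2] | z : G * G & adj z.1 z.2].

Definition degree (G : sgraph) (x : G) : nat := #|[set y | adj x y]|.

Definition max_degree (G : sgraph) : nat := \max_(x : G) degree x.

(* The neutral value #|G| exceeds every degree, so this is the true minimum
   as soon as G has a vertex; it is 0 for the graph without vertices. *)
Definition min_degree (G : sgraph) : nat := \big[minn/#|G|]_(x : G) degree x.

Section Induced.
Variables (G : sgraph) (S : {set G}).

Definition induced_adj : rel {x : G | x \in S} :=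
  fun x y => adj (val x) (val y).

Lemma induced_sym : symmetric induced_adj.
Proof. by move=> x y; apply: adj_sym. Qed.

Lemma induced_irr : irreflexive induced_adj.
Proof. by move=> x; apply: adj_irr. Qed.

Definition induced_subgraph : sgraph := SGraph induced_sym induced_irr.
End Induced.

Local Open Scope ring_scope.

(* Equal to 0 when #|G| < 2, since 0^-1 = 0. *)
Definition density (R : realType) (G : sgraph) : R :=
  #|edges G|%:R / 'C(#|G|, 2)%:R.

Definition nearly_regular (R : realType) (c : R) (G : sgraph) : Prop :=
  (max_degree G)%:R <= c * (min_degree G)%:R.

(* Main.v *)
(* Let gam = eps^2 / (144 ln (6/eps)) and let S maximise d(U) |U|^gam over all
   vertex sets U, where d is the density.  Comparing S with the whole vertex set
   and using d <= 1 gives |S| >= p^(1/gam) n = (eps/6)^(144/eps^2 ln(1/p)) n.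
   It remains to find a nearly regular induced subgraph on half of S.
   Deleting a single vertex shows that every degree in S is at least
   (1 - gam/2) times the average D, so the total excess over D of the set A of
   vertices of degree above (1 + eps/4) D is tiny.  Among the large subsets W of
   S \ A, take one maximising 2e(W) - 2 (1 - eps/4) D |W|.  All its degrees are
   at least (1 - eps/4) D: otherwise |W| would be about (1 - eps/4) |S|, and W
   would be denser than the maximality of S allows (by a relative eps^2/32 against at most 3 gam). *)
Require Import Defs.
From mathcomp Require Import all_boot all_order all_algebra.
From mathcomp Require Import reals exp.
From mathcomp Require Import sequences ring lra.

Set Implicit Arguments.
Unset Strict Implicit.
Unset Printing Implicit Defensive.

Import Order.TTheory GRing.Theory Num.Theory.

(** * Degree sums of vertex sets, edges and induced degrees *)

Section DegreeSums.
Variable G : sgraph.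
Implicit Types (U A : {set G}) (x y : G).

Definition degree_in U x : nat := \sum_(y in U) adj x y.

Definition degree_sum U : nat := \sum_(x in U) degree_in U x.

Lemma degree_in_le_card U x : (degree_in U x <= #|U|)%N.
Proof. by rewrite -sum1_card; apply: leq_sum => y _; apply: leq_b1. Qed.

Lemma degree_in_subset U A x : A \subset U -> (degree_in A x <= degree_in U x)%N.
Proof.
move=> sAU; rewrite /degree_in [leqRHS](big_setID A) /= (setIidPr sAU).
exact: leq_addr.
Qed.

Lemma degree_in_predcard U x : x \in U -> (degree_in U x <= #|U|.-1)%N.
Proof.
move=> xU; rewrite /degree_in (big_setD1 x) //= adj_irr add0n.
apply: leq_trans (degree_in_le_card _ _) _.
by rewrite (cardsD1 x U) xU.
Qed.

Lemma degree_sum_le U : (degree_sum U <= #|U| * #|U|.-1)%N.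
Proof.
rewrite -sum_nat_const; apply: leq_sum => x; exact: degree_in_predcard.
Qed.

(** Edges between [A] and [U :\: A] are counted once from each side, and either count is at most the
    sum over [A] of the degrees in [U]. *)
Lemma degree_sum_setD U A : A \subset U ->
  (degree_sum U <= degree_sum (U :\: A) + 2 * \sum_(x in A) degree_in U x)%N.
Proof.
move=> sAU; rewrite /degree_sum (big_setID A) /= (setIidPr sAU).
rewrite mul2n -addnn addnA [leqRHS]addnC leq_add2l.
have -> : (\sum_(x in U :\: A) degree_in U x =
    \sum_(x in U :\: A) degree_in A x + \sum_(x in U :\: A) degree_in (U :\: A) x)%N.
  rewrite -big_split; apply: eq_bigr => x _.
  by rewrite /degree_in (big_setID A) /= (setIidPr sAU).
rewrite addnC leq_add2l /degree_in exchange_big /=.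
apply: leq_sum => y _; rewrite (eq_bigr (fun x => adj y x : nat)); last first.
  by move=> x _; rewrite adj_sym.
by apply: degree_in_subset; apply: subsetDl.
Qed.

Lemma degree_sum_setD1 U x : x \in U ->
  (degree_sum U <= degree_sum (U :\ x) + 2 * degree_in U x)%N.
Proof.
move=> xU; have := @degree_sum_setD U [set x]; rewrite big_set1.
by apply; rewrite sub1set.
Qed.

(** Adjacent ordered pairs are grouped by their underlying edge; irreflexivity makes the two
    orientations distinct, so each fibre has at least two elements. *)
Lemma edges_le_degree_sum : (2 * #|edges G| <= degree_sum [set: G])%N.
Proof.
have -> : degree_sum [set: G] = #|[set z : G * G | adj z.1 z.2]|.
  rewrite /degree_sum /degree_in pair_big_dep /= -sum1_card.
  rewrite [RHS]big_mkcond [LHS]big_mkcond /=; apply: eq_bigr => -[x y] _ /=.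
  by rewrite !inE /=; case: (adj x y).
rewrite mulnC -sum_nat_const -sum1_card.
rewrite (partition_big (fun z : G * G => [set z.1; z.2]) (mem (edges G))) /=; last first.
  by move=> z zP; apply: imset_f; move: zP; rewrite !inE.
apply: leq_sum => e /imsetP [[x y]]; rewrite inE /= => xy ->.
have neq_xy : (x, y) != (y, x).
  by apply/eqP => -[exy _]; move: xy; rewrite exy adj_irr.
rewrite sum1_card -[X in (X <= _)%N](_ : #|[set (x, y); (y, x)]| = 2%N); last first.
  by rewrite cards2 neq_xy.
apply: subset_leq_card; apply/subsetP => z; rewrite !inE.
by case/orP => /eqP -> /=; rewrite unfold_in /= inE /= ?[adj y x]adj_sym xy //= setUC.
Qed.

Lemma degree_induced U (x : induced_subgraph U) : degree x = degree_in U (val x).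
Proof.
rewrite /degree /degree_in big_sub -sum1_card big_mkcond /=.
by apply: eq_bigr => y _; rewrite inE /= /induced_adj; case: (adj _ _).
Qed.

End DegreeSums.

Local Open Scope ring_scope.

(** One vertex of [W] settles the neutral values: it gives [0 <= u] for the maximum and [l <= #|W|]
    for the minimum. *)
Lemma nearly_regular_induced (R : realType) (G : sgraph) (W : {set G}) (c l u : R) :
  0 <= c -> u <= c * l -> W != set0 ->
  (forall x, x \in W -> l <= (degree_in W x)%:R <= u) ->
  nearly_regular c (induced_subgraph W).
Proof.
move=> c0 ul /set0Pn [x0 x0W] lu; rewrite /nearly_regular.
have max_le : (max_degree (induced_subgraph W))%:R <= u.
  rewrite /max_degree; elim/big_ind: _ => [||x _].
  - by have /andP[_] := lu _ x0W; apply: le_trans.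
  - by move=> i j iu ju; rewrite /maxn; case: ifP.
  - by rewrite degree_induced; case/andP: (lu _ (valP x)).
have min_ge : l <= (min_degree (induced_subgraph W))%:R.
  rewrite /min_degree; elim/big_ind: _ => [||x _].
  - have /andP[l0 _] := lu _ x0W; apply: le_trans l0 _; rewrite ler_nat.
    by rewrite card_sig; apply: degree_in_le_card.
  - by move=> i j il jl; rewrite /minn; case: ifP.
  - by rewrite degree_induced; case/andP: (lu _ (valP x)).
by apply: le_trans max_le (le_trans ul _); apply: ler_wpM2l.
Qed.

(** * Near regularity inside a density maximiser *)

Section DensityMaximiser.
Variables (R : realType) (G : sgraph) (S : {set G}) (gam : R).
Local Notation m := (#|S|%:R).
Local Notation T W := ((degree_sum W)%:R).
Local Notation deg W x := ((degree_in W x)%:R).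
Local Notation avg := (T S / m).

(* A consequence of the maximality of [d(S) |S|^gam], obtained from
   [x^-gam >= 1 - gam (x - 1)] at [x = m / #|W|] and freed of divisions by
   quantities that may vanish. *)
Definition density_maximiser := forall W : {set G}, W != set0 ->
  T W * (1 - gam * (m / #|W|%:R - 1)) * (m * (m - 1)) <=
  T S * (#|W|%:R * (#|W|%:R - 1)).

Hypothesis S_opt : density_maximiser.

(** Optimality is tested on [S :\ v], where the correction factor is [1 - gam / (m - 1)]. *)
Lemma maximiser_degree_ge v : 0 <= gam -> gam <= 1 -> 3 <= m :> R ->
  0 < T S :> R -> v \in S -> (1 - gam / 2) * avg <= deg S v.
Proof.
move=> gam_ge0 gam_le1 m_ge3 TS_gt0 vS.
have := degree_sum_setD1 vS.
rewrite -(ler_nat R) natrD natrM => Tdel.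
have wS : #|S :\ v|%:R = m - 1 :> R.
  by rewrite (cardsD1 v S) vS natrD [1%:R + _]addrC addrK.
have m1 : 0 < m - 1 :> R by lra.
have Sv0 : S :\ v != set0.
  by rewrite -card_gt0 -(ltr0n R) wS.
have := S_opt Sv0; rewrite wS.
have -> : T (S :\ v) * (1 - gam * (m / (m - 1) - 1)) * (m * (m - 1)) =
   T (S :\ v) * (m - 1 - gam) * m by field; rewrite gt_eqF.
move=> opt.
have mg : 0 < m - 1 - gam by lra.
have : (T S - 2 * deg S v) * ((m - 1 - gam) * m) <= T S * ((m - 1) * (m - 1 - 1)).
  apply: le_trans opt; rewrite -mulrA; apply: ler_wpM2r; last by lra.
  by apply: mulr_ge0; lra.
(* The factor [gam * (1 - gam)] is the difference between [2 * m - 2 - gam * m], which [opt] yields,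
   and [(2 - gam) * (m - 1 - gam)]. *)
move=> {}opt; have : 0 <= T S * (gam * (1 - gam)).
  by apply: mulr_ge0; [exact: ltW | apply: mulr_ge0; lra].
move=> slack; rewrite mulrA ler_pdivrMr; last by lra.
rewrite -(ler_pM2r mg).
nra.
Qed.

Definition high_degree (a : R) := [set x in S | (1 + a) * avg < deg S x].

(** Deviations from the average cancel over [S], so the excess on the high-degree set equals the
    deficit elsewhere, which [maximiser_degree_ge] bounds vertex by vertex. *)
Lemma sum_degree_high a : 0 <= gam -> gam <= 1 -> 3 <= m :> R -> 0 < T S :> R ->
  \sum_(x in high_degree a) (deg S x - avg) <= gam / 2 * T S.
Proof.
move=> gam_ge0 gam_le1 m_ge3 TS_gt0; set A := high_degree a.
have m0 : 0 < m :> R by lra.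
have sAS : A \subset S by apply/subsetP => x; rewrite inE => /andP[].
have avg_gt0 : 0 < avg :> R by rewrite divr_gt0.
have tot : \sum_(x in S) (deg S x - avg) = 0 :> R.
  rewrite sumrB sumr_const -[X in _ - X]mulr_natr divfK ?gt_eqF //.
  by rewrite /degree_sum natr_sum subrr.
move: tot; rewrite (big_setID A) /= (setIidPr sAS) => /eqP.
rewrite addr_eq0 => /eqP ->; rewrite -sumrN.
have -> : gam / 2 * T S = gam / 2 * avg * m by field; rewrite gt_eqF.
apply: le_trans (_ : \sum_(x in S :\: A) gam / 2 * avg <= _).
  apply: ler_sum => x; rewrite inE => /andP[_ xS].
  have := maximiser_degree_ge gam_ge0 gam_le1 m_ge3 TS_gt0 xS.
  by rewrite opprB; lra.
rewrite sumr_const -[leLHS]mulr_natr; apply: ler_wpM2l.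
  by apply: mulr_ge0; [lra | exact: ltW].
by rewrite ler_nat subset_leq_card // subsetDl.
Qed.


(* With [w = #|W|], [k = #|A|] and [t] twice the number of edges inside [W]:
   at the threshold size the lower bound on [t] inherited from [S :\: A]
   exceeds the upper bound from [density_maximiser]. *)
Lemma degree_sum_at_threshold (mm w k D t eps : R) :
  0 < eps -> eps <= 1 -> 0 <= gam -> gam <= eps ^+ 2 / 144 -> 8 <= eps * mm ->
  0 < D -> 0 <= t -> k * eps <= 2 * gam * mm ->
  (1 - eps / 4) * mm <= w -> w <= mm -> w - 1 < (1 - eps / 4) * mm ->
  t * (1 - gam * (mm / w - 1)) * (mm * (mm - 1)) <= D * mm * (w * (w - 1)) ->
  D * (mm - 2 * k - gam * mm) <= t + 2 * (1 - eps / 4) * D * (mm - k - w) -> False.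
Proof.
move=> eps0 eps1 gam0 gam_le m_large D0 t0 k_le w_ge w_le w_lt opt t_ge.
have m8 : 8 <= mm by nra.
have gam1 : gam <= 1 by nra.
have w0 : 0 < w by nra.
have wm : mm <= 2 * w by nra.
have ratio : mm / w - 1 <= 1 by rewrite lerBlDr ler_pdivrMr //; lra.
have {}opt : t * (1 - gam) * (mm * (mm - 1)) <= D * mm * (w * (w - 1)).
  apply: le_trans opt; apply: ler_wpM2r; first by apply: mulr_ge0; lra.
  apply: ler_wpM2l => //; rewrite lerB //; nra.
(* Since [w <= mm], the ratio [(w - 1) / (mm - 1)] is at most [w / mm]. *)
have {}opt : t * (1 - gam) * mm <= D * w ^+ 2.
  have mp : 0 < mm * (mm - 1) by apply: mulr_gt0; lra.
  rewrite -(ler_pM2r mp).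
  have -> : t * (1 - gam) * mm * (mm * (mm - 1)) =
    mm * (t * (1 - gam) * (mm * (mm - 1))) by ring.
  apply: le_trans (_ : mm * (D * mm * (w * (w - 1))) <= _).
    by apply: ler_wpM2l => //; lra.
  have : 0 <= D * mm * w * (mm - w) by rewrite !mulr_ge0 //; lra.
  lra.
set c := mm - w.
have wE : w = mm - c by rewrite /c; ring.
clearbody c; subst w.
(* Up to the factor [D], the terms in [k] cancel except for [k * eps / 2], which is at most
   [gam * mm]. *)
have {}t_ge : D * (mm - 2 * c + eps / 2 * c - 2 * gam * mm) <= t.
  have : 0 <= D * (2 * gam * mm - k * eps) by apply: mulr_ge0; lra.
  lra.
have {}opt : (1 - gam) * (mm - 2 * c + eps / 2 * c - 2 * gam * mm) * mm <= (mm - c) ^+ 2.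
  rewrite -(ler_pM2l D0); apply: le_trans opt.
  rewrite [leLHS](_ : _ = D * (mm - 2 * c + eps / 2 * c - 2 * gam * mm) * ((1 - gam) * mm)); last first.
    by ring.
  rewrite -[leRHS]mulrA ler_wpM2r // mulr_ge0 //; lra.
have c_le : c <= eps / 4 * mm by lra.
(* Rounding costs less than one vertex, and [1 <= eps / 8 * mm]. *)
have c_ge : eps / 8 * mm <= c by lra.
have c0 : 0 <= c by nra.
have h1 : 0 <= c * (eps / 4 * mm - c) by apply: mulr_ge0; lra.
have h2 : 0 <= gam * mm * ((2 - eps / 2) * c + 2 * gam * mm).
  by rewrite mulr_ge0 ?mulr_ge0 ?addr_ge0 ?mulr_ge0 ?mulr_ge0 //; lra.
(* Expanding [opt], with [h1] absorbing [c ^+ 2]. It leads to [eps ^+ 2 / 32 <= 3 * gam <= eps ^+ 2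
   / 48], which is absurd. *)
have h3 : (eps / 4 * c) * mm <= (3 * gam * mm) * mm by lra.
have {}h3 : eps / 4 * c <= 3 * gam * mm by move: h3; rewrite ler_pM2r //; lra.
have h4 : eps / 4 * (eps / 8 * mm) <= eps / 4 * c by apply: ler_wpM2l => //; lra.
have h5 : gam * mm <= eps ^+ 2 / 144 * mm by apply: ler_wpM2r => //; lra.
have : 0 < eps ^+ 2 * mm by apply: mulr_gt0; [exact: exprn_gt0 | lra].
lra.
Qed.

Lemma maximiser_nearly_regular (eps : R) :
  0 < eps -> eps <= 1 -> 0 <= gam -> gam <= eps ^+ 2 / 144 ->
  8 <= eps * m -> 0 < T S :> R ->
  exists W : {set G}, m / 2 <= #|W|%:R :> R /\
    nearly_regular (1 + eps) (induced_subgraph W).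
Proof.
move=> eps0 eps1 gam0 gam_le m_large TS0.
have m8 : 8 <= m :> R by nra.
have m0 : 0 < m :> R by lra.
have gam1 : gam <= 1 by nra.
have := sum_degree_high (eps / 4) gam0 gam1 (le_trans _ m8) TS0.
set A := high_degree (eps / 4); set D := avg.
have D0 : 0 < D by rewrite divr_gt0.
have TD : T S = D * m by rewrite divfK // gt_eqF.
have sAS : A \subset S by apply/subsetP => x; rewrite inE => /andP[].
have -> : 3 <= 8 :> R by lra.
move=> /(_ isT) sumA.
have kA : #|A|%:R * eps <= 2 * gam * m.
  have : #|A|%:R * (eps / 4 * D) <= gam / 2 * T S.
    apply: le_trans sumA; rewrite [leLHS]mulr_natl -sumr_const.
    by apply: ler_sum => x; rewrite inE => /andP[_]; rewrite -/D; lra.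
  by rewrite TD => h; rewrite -(ler_pM2r D0); lra.
have degA : \sum_(x in A) deg S x <= #|A|%:R * D + gam / 2 * T S.
  by move: sumA; rewrite sumrB sumr_const -[X in _ - X]mulr_natl; lra.
pose B := S :\: A.
have cardB : #|B|%:R = m - #|A|%:R :> R.
  by rewrite -(cardsID A S) (setIidPr sAS) natrD addrAC subrr add0r.
have TB : D * (m - 2 * #|A|%:R - gam * m) <= T B.
  have := degree_sum_setD sAS.
  rewrite -(ler_nat R) natrD natrM natr_sum TD; move: degA; rewrite TD -/B; lra.
(* The price per vertex is such that deleting a vertex of degree below [(1 - eps / 4) * D] increases
   [F]. *)
pose F (W : {set G}) : R := T W - 2 * (1 - eps / 4) * D * #|W|%:R.
pose P (W : {set G}) := (W \subset B) && ((1 - eps / 4) * m <= #|W|%:R).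
have PB : P B.
  rewrite /P subxx cardB /=.
  have : #|A|%:R * eps <= (eps / 4 * m) * eps.
    apply: le_trans kA _.
    have : gam * m <= eps ^+ 2 / 144 * m by apply: ler_wpM2r => //; lra.
    have : 0 <= eps ^+ 2 * m by rewrite mulr_ge0 ?sqr_ge0 //; lra.
    lra.
  rewrite ler_pM2r //; lra.
case: (arg_maxP F PB) => W /andP[sWB W_large] maxW.
have W0 : W != set0.
  rewrite -card_gt0 -(ltr0n R); apply: lt_le_trans W_large; apply: mulr_gt0; lra.
have W_le : #|W|%:R <= m :> R.
  by rewrite ler_nat subset_leq_card // (subset_trans sWB) // subsetDl.
exists W; split; first by nra.
apply: (@nearly_regular_induced _ _ _ _ ((1 - eps / 4) * D) ((1 + eps / 4) * D)) => //.
- lra.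
(* Here [(1 + eps) * (1 - eps / 4)] exceeds [1 + eps / 4] by [eps / 2 - eps ^+ 2 / 4]. *)
- by rewrite [leRHS]mulrA ler_wpM2r //; [lra | nra].
move=> x xW; apply/andP; split; last first.
  have := subsetP sWB x xW; rewrite !inE negb_and -leNgt => /andP[/orP[/negP//|h] xS].
  apply: le_trans h; rewrite ler_nat; apply: degree_in_subset.
  by rewrite (subset_trans sWB) // subsetDl.
(* Deleting [x] would increase [F], so [W :\ x] must violate the size bound: [W] is at the
   threshold. The lower bound on [T W] comes from [F B <= F W]. *)
rewrite leNgt; apply/negP => deg_small.
have cardWx : #|W :\ x|%:R = #|W|%:R - 1 :> R.
  by rewrite (cardsD1 x W) xW natrD [1%:R + _]addrC addrK.
have TWx : T W <= T (W :\ x) + 2 * deg W x :> R.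
  by rewrite -natrM -natrD ler_nat degree_sum_setD1.
apply: (@degree_sum_at_threshold m #|W|%:R #|A|%:R D (T W) eps) => //.
- rewrite ltNge; apply/negP => Wx_large.
  have /maxW : P (W :\ x) by rewrite /P cardWx Wx_large (subset_trans (subD1set _ _)).
  rewrite /F cardWx /=; lra.
- by rewrite -TD; apply: S_opt.
- by have := maxW _ PB; rewrite /F cardB /=; lra.
Qed.

End DensityMaximiser.

(** * The weighted density and its maximisers *)

Lemma powR_ge_tangent (R : realType) (g x : R) :
  0 <= g -> 0 < x -> (1 - g * (x - 1)) * x `^ g <= 1.
Proof.
move=> g0 x0.
have -> : x `^ g = expR (g * ln x) by rewrite mulrC expRM lnK.
have lnx : ln x <= x - 1.
  by have := @le_ln1Dx R (x - 1); rewrite addrCA subrr addr0; apply; lra.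
have le_exp : 1 - g * (x - 1) <= expR (- (g * ln x)).
  apply: le_trans (expR_ge1Dx _); rewrite lerD2l lerN2; exact: ler_wpM2l.
apply: le_trans (_ : expR (- (g * ln x)) * expR (g * ln x) <= _).
  by rewrite ler_wpM2r // expR_ge0.
by rewrite -expRD addNr expR0.
Qed.

(* It is 0 for [#|U| <= 1], since the denominator vanishes. *)
Definition weighted_density (R : realType) (G : sgraph) (g : R) (U : {set G}) : R :=
  (degree_sum U)%:R / (#|U|%:R * (#|U|%:R - 1)) * #|U|%:R `^ g.

Lemma degree_sum_le_real (R : realType) (G : sgraph) (U : {set G}) :
  (degree_sum U)%:R <= #|U|%:R * (#|U|%:R - 1) :> R.
Proof.
have [->|U0] := eqVneq U set0.
  by rewrite /degree_sum big_set0 cards0 mul0r.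
rewrite -card_gt0 in U0.
by rewrite -[X in _ - X]/(1%:R) -natrB // subn1 -natrM ler_nat degree_sum_le.
Qed.

(** Multiply the claim by [#|S| ^ g], split as [(#|S| / #|W|) ^ g] times [#|W| ^ g]. The tangent
    bound absorbs the first factor, leaving maximality with denominators cleared. *)
Lemma weighted_density_max (R : realType) (G : sgraph) (g : R) (S : {set G}) :
  0 <= g -> 0 < (degree_sum S)%:R :> R ->
  (forall U : {set G}, weighted_density g U <= weighted_density g S) ->
  density_maximiser S g.
Proof.
move=> g0 TS0 maxS W W0.
have m0 : 0 < #|S|%:R :> R.
  rewrite ltr0n card_gt0; apply/eqP => S0.
  by move: TS0; rewrite S0 /degree_sum big_set0 ltxx.
have mm0 : 0 < #|S|%:R * (#|S|%:R - 1) :> R.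
  exact: lt_le_trans TS0 (degree_sum_le_real _ _).
have w0 : 0 < #|W|%:R :> R by rewrite ltr0n card_gt0.
(* For a singleton the denominators cannot be cleared, but both sides of the claim are 0. *)
have [w1|w1] := leqP #|W| 1.
  have wE : #|W| = 1%N by apply/eqP; rewrite eqn_leq w1 -(ltr0n R).
  have -> : degree_sum W = 0%N.
    by apply/eqP; rewrite -leqn0; have := degree_sum_le W; rewrite wE.
  by rewrite wE subrr !mulr0 !mul0r.
have ww0 : 0 < #|W|%:R * (#|W|%:R - 1) :> R by rewrite mulr_gt0 // subr_gt0 ltr1n.
have := maxS W; rewrite /weighted_density.
have bern := powR_ge_tangent g0 (divr_gt0 m0 w0).
have powE : #|S|%:R `^ g = (#|S|%:R / #|W|%:R) `^ g * #|W|%:R `^ g :> R.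
  by rewrite -powRM ?divfK ?gt_eqF // ?divr_ge0 // ltW.
have pS : 0 < #|S|%:R `^ g :> R by rewrite powR_gt0.
have pW : 0 < #|W|%:R `^ g :> R by rewrite powR_gt0.
move=> le_phi; rewrite -(ler_pM2r pS).
apply: le_trans (_ : (degree_sum W)%:R * (#|S|%:R * (#|S|%:R - 1)) * #|W|%:R `^ g <= _).
  rewrite powE [leLHS]mulrA ler_pM2r //.
  rewrite [_ * (1 - _) * _]mulrAC -[leLHS]mulrA.
  by rewrite ler_piMr // mulr_ge0 // ltW.
have := ler_wpM2l (ltW (mulr_gt0 mm0 ww0)) le_phi.
rewrite [leLHS](_ : _ = (degree_sum W)%:R * (#|S|%:R * (#|S|%:R - 1)) * #|W|%:R `^ g); last first.
  by field; move: ww0; rewrite pmulr_rgt0 // => ?; rewrite !gt_eqF.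
rewrite [leRHS](_ : _ = (degree_sum S)%:R * (#|W|%:R * (#|W|%:R - 1)) * #|S|%:R `^ g) //.
by field; move: mm0; rewrite pmulr_rgt0 // => ?; rewrite !gt_eqF.
Qed.

(** Both sides have logarithm [144 / eps ^+ 2 * ln (6 / eps) * ln p]. *)
Lemma ln_exponent (R : realType) (eps p : R) : 0 < eps -> eps < 6 -> 0 < p ->
  (eps / 6) `^ (144 / eps ^+ 2 * ln (1 / p)) =
  p `^ (eps ^+ 2 / (144 * ln (6 / eps)))^-1.
Proof.
move=> eps0 eps6 p0.
have r0 : 0 < eps / 6 by rewrite divr_gt0.
have L0 : 0 < ln (6 / eps) by rewrite ln_gt0 // ltr_pdivlMr // mul1r.
rewrite -[LHS]lnK ?posrE ?powR_gt0 // -[RHS]lnK ?posrE ?powR_gt0 //.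
rewrite !ln_powR div1r lnV ?posrE //.
have -> : ln (eps / 6) = - ln (6 / eps) by rewrite -lnV ?posrE ?divr_gt0 // invf_div.
congr expR; field; rewrite !gt_eqF //.
Qed.

Lemma weighted_density_setT (R : realType) (G : sgraph) (g p : R) :
  0 < p -> p <= density R G -> p * #|G|%:R `^ g <= weighted_density g [set: G].
Proof.
move=> p0; rewrite /density /weighted_density cardsT => p_le.
rewrite ler_wpM2r ?powR_ge0 //; apply: le_trans p_le _.
(* With at most one vertex the density is 0 by convention, and nonnegativity suffices. *)
have [n1|n1] := leqP #|G| 1.
  rewrite bin_small // invr0 mulr0 divr_ge0 // -cardsT.
  exact: le_trans (degree_sum_le_real _ _).
have binE : 2 * 'C(#|G|, 2)%:R = #|G|%:R * (#|G|%:R - 1) :> R.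
  rewrite -[X in _ - X]/(1%:R) -natrB 1?ltnW // -!natrM subn1.
  by rewrite mulnC (bin_ffact _ 2) ffactnS ffactn1.
have C0 : 0 < 'C(#|G|, 2)%:R :> R by rewrite ltr0n bin_gt0.
rewrite -binE ler_pdivrMr // mulrAC ler_pdivlMr; last by rewrite mulr_gt0.
rewrite [leLHS]mulrA; apply: ler_wpM2r; first exact: ltW.
rewrite mulrC -natrM ler_nat; exact: edges_le_degree_sum.
Qed.

(** * Choice of constants and conclusion *)

Theorem theorem1p2 (R : realType) :
  exists eps0 : R, 0 < eps0 /\
    forall eps : R, 0 < eps -> eps <= eps0 ->
    forall p : R, 0 < p -> p < 1 ->
    exists n0 : nat, forall n : nat, (n0 <= n)%N ->
    forall G : sgraph, #|G| = n -> p <= density R G ->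
    exists S : {set G},
      2^-1 * (eps / 6) `^ (144 / eps ^+ 2 * ln (1 / p)) * n%:R <= #|S|%:R
      /\ nearly_regular (1 + eps) (induced_subgraph S).
Proof.
(* This bound ensures [eps <= 1] and [1 <= ln (6 / eps)], hence [g <= eps ^+ 2 / 144]. *)
exists (expR (- 1)); split; first exact: expR_gt0.
move=> eps eps0 eps_le p p0 p1.
have eps1 : eps <= 1 by rewrite (le_trans eps_le) // -[leRHS](@expR0 R) ler_expR lerN10.
have L1 : 1 <= ln (6 / eps).
  rewrite -[leLHS](@expRK R) ler_ln ?posrE ?expR_gt0 ?divr_gt0 //.
  rewrite ler_pdivlMr // mulrC.
  apply: le_trans (_ : expR (- 1) * expR 1 <= _); first by rewrite ler_wpM2r // expR_ge0.
  by rewrite -expRD addNr expR0 ler1n.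
pose g := eps ^+ 2 / (144 * ln (6 / eps)).
have e2 : 0 < eps ^+ 2 by rewrite exprn_gt0.
have g0 : 0 < g by rewrite divr_gt0 // mulr_gt0 //; lra.
have g_le : g <= eps ^+ 2 / 144.
  apply: ler_wpM2l; first exact: ltW.
  by rewrite lef_pV2 ?posrE; lra.
rewrite ln_exponent //; last by lra.
rewrite -/g.
set K := p `^ g^-1; have K0 : 0 < K by rewrite powR_gt0.
(* Chosen so that [#|S| >= K * n] implies the size condition [8 <= eps * #|S|]. *)
exists (Num.bound (8 / (eps * K))) => n n_ge G Gn p_le.
have nK : 8 <= eps * (K * n%:R).
  rewrite mulrA mulrC -ler_pdivrMr ?mulr_gt0 //.
  apply: le_trans (ltW (archi_boundP _)) _; first by rewrite divr_ge0 // mulr_ge0 // ltW.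
  by rewrite ler_nat.
have n0 : 0 < n%:R :> R.
  rewrite ltr0n lt0n; apply/eqP => n0; move: nK; rewrite n0 !mulr0; lra.
case: (@arg_maxP _ _ _ [set: G] xpredT (weighted_density g) isT) => S _ maxS.
have phiS : p * n%:R `^ g <= weighted_density g S.
  by rewrite -Gn; apply: le_trans (weighted_density_setT _ p0 p_le) (maxS _ isT).
have phi0 : 0 < weighted_density g S.
  by apply: lt_le_trans phiS; rewrite mulr_gt0 // powR_gt0.
have TS0 : 0 < (degree_sum S)%:R :> R.
  rewrite lt_neqAle ler0n andbT; apply/eqP => TS0.
  by move: phi0; rewrite /weighted_density -TS0 !mul0r ltxx.
have S_large : K * n%:R <= #|S|%:R.
  have mm0 := lt_le_trans TS0 (degree_sum_le_real R S).
  have : p * n%:R `^ g <= #|S|%:R `^ g.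
    apply: le_trans phiS _; rewrite /weighted_density ler_piMl ?powR_ge0 //.
    by rewrite ler_pdivrMr // mul1r degree_sum_le_real.
  move=> h; have gV : 0 <= g^-1 by rewrite invr_ge0 ltW.
  have := ge0_ler_powR gV _ _ h.
  rewrite !nnegrE powR_ge0 mulr_ge0 ?powR_ge0 ?(ltW p0) // => /(_ isT isT).
  rewrite powRM ?powR_ge0 ?(ltW p0) // -!powRrM divff ?gt_eqF //.
  by rewrite !powRr1 // ltW.
have S_opt := weighted_density_max (ltW g0) TS0 (fun U => maxS U isT).
have [|W [W_large W_reg]] := maximiser_nearly_regular S_opt eps0 eps1 (ltW g0) g_le _ TS0.
  by apply: le_trans nK _; rewrite ler_pM2l.
exists W; split=> //; apply: le_trans W_large.
rewrite -mulrA mulrC; apply: ler_wpM2r => //; lra.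
Qed.
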